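(* Let $p > 0$ be a real number and let $A$ be a complex $n \times n$ matrix whose spectrum belongs to $$\mathcal{P}_e = \left\{\lambda \in \mathbb{C} : (\mathrm{Im}\,\lambda)^2 > 2p\, \mathrm{Re}\, \lambda \right\}.$$ Let $H = H^* > 0$ be a solution to $$HA + A^*H - \frac{1}{2p}A^*HA + \frac{1}{4p}\left(HA^2+(A^* )^2H\right) = -I.$$ If $B$ is a complex $n \times n$ matrix such that $$HB + B^*H - \frac{1}{2p}\left(A^*HB + B^*HA + B^*HB\right) + \frac{1}{4p}\left(H(AB + BA + B^2) + (AB + BA + B^2)^*H\right) < I,$$ then the spectrum of the matrix $A + B$ also belongs to $\mathcal{P}_e$.
   Context: $M^*$ denotes the conjugate transpose of $M$, and $I$ is the $n\times n$ identity matrix. For Hermitian matrices $M, N$, $M > 0$ means that $M$ is positive definite and $M < N$ means that $N - M$ is positive definite. *)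

(* Defs.v *)
From mathcomp Require Import all_boot all_order all_algebra.
From mathcomp Require Import reals.
From mathcomp.real_closed Require Import complex.

Set Implicit Arguments.
Unset Strict Implicit.
Unset Printing Implicit Defensive.

Import Order.TTheory GRing.Theory Num.Theory.
Local Open Scope ring_scope.
Local Open Scope complex_scope.
Local Open Scope sesquilinear_scope.

(* In the partial order of R[i], 0 < z forces z to be real. *)
Definition posdefmx (R : realType) (n : nat) (M : 'M[R[i]]_n) : Prop :=
  M \is hermsymmx /\
  forall x : 'cV[R[i]]_n, x != 0 -> 0 < (x ^t* *m M *m x) 0 0.

Definition ltdefmx (R : realType) (n : nat) (M N : 'M[R[i]]_n) : Prop :=
  posdefmx (N - M).

(* The exterior of the parabola (Im z)^2 = 2 p Re z. *)
Definition parabola_ext (R : realType) (p : R) : {pred R[i]} :=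
  [pred z : R[i] | complex.Im z ^+ 2 > 2 * p * complex.Re z].

(* Main.v *)
(* With C = A + B and ' the conjugate transpose, adding the two hypotheses shows
   that
     G(C) := HC + C'H - C'HC/(2p) + (HCC + C'C'H)/(4p)
   is negative definite. If Cx = lx with x != 0, then
     x'G(C)x = (2 Re l - (Im l)^2/p) x'Hx,
   and x'Hx > 0 forces (Im l)^2 > 2p Re l. *)
Require Import Defs.
From mathcomp Require Import all_boot all_order all_algebra.
From mathcomp Require Import reals.
From mathcomp.real_closed Require Import complex.
From mathcomp Require Import ring.

Set Implicit Arguments.
Unset Strict Implicit.
Unset Printing Implicit Defensive.

Import Order.TTheory GRing.Theory Num.Theory.
Local Open Scope ring_scope.
Local Open Scope complex_scope.
Local Open Scope sesquilinear_scope.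

(** [eigenvalue] speaks of row vectors, while the quadratic form needs columns. The bridge is that
    [A - a%:M] and its transpose are invertible together. *)
Lemma eigenvalue_tr (F : fieldType) (n : nat) (A : 'M[F]_n) (a : F) :
  eigenvalue A^T a = eigenvalue A a.
Proof.
rewrite /eigenvalue /eigenspace !kermx_eq0 !row_free_unit -unitmx_tr.
by rewrite linearB /= trmxK tr_scalar_mx.
Qed.

Lemma eigenvalue_colP (F : fieldType) (n : nat) (A : 'M[F]_n) (a : F) :
  reflect (exists2 x : 'cV[F]_n, A *m x = a *: x & x != 0) (eigenvalue A a).
Proof.
rewrite -eigenvalue_tr; apply: (iffP eigenvalueP) => -[v vA v0].
  exists v^T; last by rewrite trmx_eq0.
  by rewrite -[A]trmxK -trmx_mul vA linearZ.
by exists v^T; rewrite ?trmx_eq0 // -trmx_mul vA linearZ.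
Qed.

Definition parabola_mx (R : realType) (n : nat) (p : R) (H C : 'M[R[i]]_n) :=
  H *m C + C ^t* *m H
    - (1 / (2 * p))%:C *: (C ^t* *m H *m C)
    + (1 / (4 * p))%:C *: (H *m (C *m C) + (C ^t* *m C ^t*) *m H).

(** [parabola_mx p H] is quadratic in [C]: its increment at [A] consists of the terms in [B] alone
    and the cross terms, which is the form bounded in the hypothesis on [B]. *)
Lemma parabola_mxD (R : realType) (n : nat) (p : R) (H A B : 'M[R[i]]_n) :
  parabola_mx p H (A + B) = parabola_mx p H A +
    (H *m B + B ^t* *m H
      - (1 / (2 * p))%:C *:
          (A ^t* *m H *m B + B ^t* *m H *m A + B ^t* *m H *m B)
      + (1 / (4 * p))%:C *:
          (H *m (A *m B + B *m A + B *m B)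
           + (A *m B + B *m A + B *m B) ^t* *m H)).
Proof.
rewrite /parabola_mx.
have -> : (A *m B + B *m A + B *m B) ^t* =
    B ^t* *m A ^t* + A ^t* *m B ^t* + B ^t* *m B ^t*.
  by rewrite !raddfD /= !trmx_mul !map_mxM.
have -> : (A + B) ^t* = A ^t* + B ^t* by rewrite !raddfD.
move: (A ^t*) (B ^t*) => A' B'.
move: (1 / (2 * p))%:C (1 / (4 * p))%:C => c d.
rewrite !(mulmxDl, mulmxDr).
(* With every product turned into an opaque matrix, the identity is linear in these matrices, so
   [ring] can settle it entrywise despite noncommutativity. *)
repeat match goal with |- context [?M *m ?N] => move: (M *m N) => ? end.
by apply/matrixP => i j; rewrite !mxE; ring.
Qed.

(** [C] acts on [x] as [l], and [C ^t*] acts on [x ^t*] from the right as [l^*], so each term is a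
    scalar multiple of [x ^t* *m H *m x]. *)
Lemma parabola_mx_eigen (R : realType) (n : nat) (p : R) (H C : 'M[R[i]]_n)
    (l : R[i]) (x : 'cV[R[i]]_n) :
  C *m x = l *: x -> p != 0 ->
  x ^t* *m parabola_mx p H C *m x =
    (2 * complex.Re l - complex.Im l ^+ 2 / p)%:C *: (x ^t* *m H *m x).
Proof.
move=> Cx p0.
have xC : x ^t* *m C ^t* = l^* *: x ^t*.
  by rewrite -map_mxM -trmx_mul Cx linearZ /= map_mxZ.
rewrite /parabola_mx; move: (x ^t*) (C ^t*) xC => y C' xC.
have EZ c M : y *m (c *: M) *m x = c *: (y *m M *m x).
  by rewrite -scalemxAr -scalemxAl.
have E1 : y *m (H *m C) *m x = l *: (y *m H *m x).
  by rewrite -!mulmxA Cx -!scalemxAr.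
have E2 : y *m (C' *m H) *m x = l^* *: (y *m H *m x).
  by rewrite !mulmxA xC -!scalemxAl.
have E3 : y *m (C' *m H *m C) *m x = (l^* * l) *: (y *m H *m x).
  by rewrite !mulmxA xC -[_ *m C *m x]mulmxA Cx -!scalemxAl -scalemxAr scalerA.
have E4 : y *m (H *m (C *m C)) *m x = (l * l) *: (y *m H *m x).
  by rewrite -!mulmxA Cx -scalemxAr Cx -!scalemxAr scalerA.
have E5 : y *m (C' *m C' *m H) *m x = (l^* * l^*) *: (y *m H *m x).
  by rewrite !mulmxA xC -scalemxAl xC -!scalemxAl scalerA.
rewrite !(mulmxDr, mulmxDl, mulmxN, mulNmx).
rewrite !EZ !(mulmxDr, mulmxDl) E1 E2 E3 E4 E5.
rewrite -!scalerDl !scalerA -scalerBl -scalerDl; congr (_ *: _).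
(* For [l = a + ib], the quadratic terms are [- (a^2 + b^2) / (2p) + (a^2 - b^2) / (2p) = - b^2 /
   p]: the squares of the real part cancel. *)
case: l {Cx xC E1 E2 E3 E4 E5} => a b; apply/eqP; rewrite eq_complex /=.
by apply/andP; split; apply/eqP; field.
Qed.

Theorem theorem11 (R : realType) (n : nat) (p : R) (A H B : 'M[R[i]]_n) :
  0 < p ->
  (forall l : R[i], eigenvalue A l -> l \in parabola_ext p) ->
  posdefmx H ->
  H *m A + A ^t* *m H
    - (1 / (2 * p))%:C *: (A ^t* *m H *m A)
    + (1 / (4 * p))%:C *: (H *m (A *m A) + (A ^t* *m A ^t*) *m H)
  = - 1%:M ->
  ltdefmx
    (H *m B + B ^t* *m H
      - (1 / (2 * p))%:C *:
          (A ^t* *m H *m B + B ^t* *m H *m A + B ^t* *m H *m B)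
      + (1 / (4 * p))%:C *:
          (H *m (A *m B + B *m A + B *m B)
           + (A *m B + B *m A + B *m B) ^t* *m H))
    1%:M ->
  forall l : R[i], eigenvalue (A + B) l -> l \in parabola_ext p.
Proof.
move=> p0 _ [_ Hpos] HA [_ HB] l /eigenvalue_colP[x Cx x0].
(* The identity matrix cancels because [HA] says that [parabola_mx p H A] is [- 1%:M]. *)
have := HB x x0; rewrite [1%:M - _](_ : _ = - parabola_mx p H (A + B)).
  rewrite mulmxN mulNmx (parabola_mx_eigen _ Cx) ?gt_eqF // -scaleNr.
  (* Dividing by the positive number [x ^t* *m H *m x] leaves an inequality between embedded reals,
     which [ltcR] brings back to [R]. *)
  rewrite mxE pmulr_lgt0 ?Hpos // -raddfN ltcR oppr_gt0 subr_lt0.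
  by rewrite ltr_pdivlMr // mulrAC.
by rewrite parabola_mxD [parabola_mx p H A]HA [RHS]opprD opprK.
Qed.
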